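(* Let $T>0$, $A_0,A_1,\dots,A_m\in\mathbb R^{n\times n}$, $S_0\in\mathbb R^{n\times k}$, $v\in\mathbb R^k$, $u=(u_1,\dots,u_m)^\top\in L^2([0,T];\mathbb R^m)$, and let $S(t)$, $t\in[0,T]$, be the solution of $$\dot S(t)=A_0S(t)+\sum_{i=1}^m A_iS(t)u_i(t),\qquad S(0)=S_0v.$$ Let $P$ be the reachability Gramian $P=\int_0^T Z(t,S_0S_0^\top)\,\mathrm dt$ and let $(p_i)_{i=1}^n$ be an orthonormal basis of $\mathbb R^n$ consisting of eigenvectors of $P$. Then, for each $i\in\{1,\dots,n\}$, $$\int_0^T|\langle S(t),p_i\rangle|^2\,\mathrm dt\le\lambda_i\exp\left\{\|u\|_{L^2([0,T])}^2\right\}\|v\|^2,$$ where $\lambda_i$ is the eigenvalue of $P$ corresponding to $p_i$.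
   Context: For a positive semidefinite matrix $M\in\mathbb R^{n\times n}$, $Z(t,M)$, $t\in[0,T]$, denotes the solution of the matrix differential equation $$\dot Z(t)=A_0Z(t)+Z(t)A_0^\top+\sum_{i=1}^m A_iZ(t)A_i^\top,\qquad Z(0)=M.$$ $\|\cdot\|$ is the Euclidean norm and $\|u\|_{L^2([0,T])}^2=\int_0^T\|u(t)\|^2\,\mathrm dt$. Solutions of the bilinear equation are absolutely continuous functions satisfying the associated integral equation. No stability assumption is made on $A_0,\dots,A_m$. *)

(* Defs.v *)
From HB Require Import structures.
From mathcomp Require Export all_boot all_order all_algebra.
From mathcomp Require Export all_classical all_reals all_analysis.
Export Order.TTheory GRing.Theory Num.Theory.
Export numFieldNormedType.Exports.

Set Implicit Arguments.
Unset Strict Implicit.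
Unset Printing Implicit Defensive.

Local Open Scope classical_set_scope.
Local Open Scope ring_scope.

(* The library's norm `|x| on matrices is the max-norm, hence a separate
   Euclidean norm. *)
Definition inner (R : realType) (n : nat) (x y : 'cV[R]_n) : R :=
  \sum_(i < n) x i 0 * y i 0.

Definition enorm (R : realType) (n : nat) (x : 'cV[R]_n) : R :=
  Num.sqrt (inner x x).

Definition mx_integral (R : realType) (n k : nat) (D : set R)
    (F : R -> 'M[R]_(n, k)) : 'M[R]_(n, k) :=
  \matrix_(i, j) \int[lebesgue_measure]_(t in D) F t i j.

Definition L2_fun (R : realType) (m : nat) (T : R) (u : R -> 'cV[R]_m) : Prop :=
  (forall i, measurable_fun `[0, T] (fun t => u t i 0)) /\
  lebesgue_measure.-integrable `[0, T] (fun t => (enorm (u t) ^+ 2)%:E).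

Definition L2_sqnorm (R : realType) (m : nat) (T : R) (u : R -> 'cV[R]_m) : R :=
  \int[lebesgue_measure]_(t in `[0, T]) (enorm (u t) ^+ 2).

(* All norms on 'M[R]_(n, k) are equivalent, so the choice of the library's
   max-norm is immaterial here. *)
Definition abs_continuous (R : realType) (n k : nat) (a b : R)
    (f : R -> 'M[R]_(n, k)) : Prop :=
  forall e : R, 0 < e -> exists2 d : R, 0 < d &
    forall (N : nat) (x y : 'I_N -> R),
      (forall i, [/\ a <= x i, x i <= y i & y i <= b]) ->
      trivIset [set: 'I_N] (fun i => `]x i, y i[%classic) ->
      \sum_(i < N) (y i - x i) < d ->
      \sum_(i < N) `|f (y i) - f (x i)| < e.

(* For absolutely continuous S and u in L^2 the integrand below is integrable
   on [0, T], so the (total) integral has its usual meaning. *)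
Definition bilinear_solution (R : realType) (n m : nat) (T : R)
    (A0 : 'M[R]_n) (A : 'I_m -> 'M[R]_n) (u : R -> 'cV[R]_m) (x0 : 'cV[R]_n)
    (S : R -> 'cV[R]_n) : Prop :=
  abs_continuous 0 T S /\
  forall t, t \in `[0, T] ->
    S t = x0 + mx_integral `[0, t]
                 (fun s => A0 *m S s + \sum_(i < m) u s i 0 *: (A i *m S s)).

(* Classical solution of the matrix equation: the one-sided derivatives at the
   endpoints follow from the equation on the open interval and continuity up
   to the boundary. *)
Definition lyapunov_solution (R : realType) (n m : nat) (T : R)
    (A0 : 'M[R]_n) (A : 'I_m -> 'M[R]_n) (M : 'M[R]_n)
    (Z : R -> 'M[R]_n) : Prop :=
  [/\ Z 0 = M,
      {within `[0, T], continuous Z} &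
      forall t, t \in `]0, T[ ->
        is_derive t 1 Z
          (A0 *m Z t + Z t *m A0^T + \sum_(i < m) A i *m Z t *m (A i)^T)].

(* An orthonormal family of n vectors in R^n is automatically a basis. *)
Definition orthonormal_basis (R : realType) (n : nat)
    (p : 'I_n -> 'cV[R]_n) : Prop :=
  forall i j, inner (p i) (p j) = (i == j)%:R.

(* Main.v *)
Require Import Defs.
From mathcomp Require Import measurable_realfun ring lra.

Set Implicit Arguments.
Unset Strict Implicit.
Unset Printing Implicit Defensive.

Local Open Scope classical_set_scope.
Local Open Scope ring_scope.

(** The estimate is the integral over [0, T], tested against an eigenvector of
    P, of the Loewner inequality
      S(t) S(t)^T <= exp(int_0^t |u|^2) |v|^2 Z(t)      (bilinear_le_lyapunov).
    The usual argument for it is that X(t) = exp(- int_0^t |u|^2) S(t) S(t)^T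
    satisfies X' <= L(X), where L(X) = A0 X + X A0^T + sum_l A_l X A_l^T is the
    operator of the matrix equation, because
      u_l (A_l S S^T + S S^T A_l^T) <= A_l S S^T A_l^T + u_l^2 S S^T,
    and that the flow of L preserves positive semidefiniteness.

    Both facts are proved here for finite time steps, so that neither the
    product rule for absolutely continuous functions nor the flow of L is
    needed. With h = t - s and
      Phi_h(X) = (1 + h A0) X (1 + h A0)^T + h sum_l A_l X A_l^T,
    which preserves semidefiniteness and is X + h L(X) up to O(h^2), one has
      Z(t) >= Phi_h(Z(s)) - C h^2                       (lyapunov_step),
      S(t) S(t)^T <= exp(int_s^t |u|^2) Phi_h(S(s) S(s)^T)
                     + C h int_s^t w^2                  (bilinear_step),
    where w = 1 + sum_l |u_l| is square integrable. The second inequality comes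
    from the expansion
      S(t) = S(s) + h A0 S(s) + sum_l (int_s^t u_l) A_l S(s) + O(h int_s^t w^2)
    and the Cauchy-Schwarz inequality, used once for vectors
    (weighted_cauchy_schwarz) and once in the form
    (int_s^t u_l)^2 <= h int_s^t u_l^2.
    Hence D = |v|^2 Z - X satisfies D(t) >= Phi_h(D(s)) - C h int_s^t w^2.
    Over N equal steps these errors add up to O(1 / N), since the integral of
    w^2 is additive; as D(0) >= 0, letting N tend to infinity gives D >= 0
    (euler_comparison). *)

(** * Inner product and max-norm of real matrices *)

Section InnerProduct.
Variables (R : realType) (n : nat).
Implicit Types (x y z : 'cV[R]_n) (a : R).

Lemma innerE x y : inner x y = (x^T *m y) 0 0.
Proof. by rewrite !mxE; apply: eq_bigr => i _; rewrite mxE. Qed.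

Lemma innerC x y : inner x y = inner y x.
Proof. by apply: eq_bigr => i _; rewrite mulrC. Qed.

Lemma innerDr x y z : inner x (y + z) = inner x y + inner x z.
Proof. by rewrite !innerE mulmxDr mxE. Qed.

Lemma innerDl x y z : inner (y + z) x = inner y x + inner z x.
Proof. by rewrite innerC innerDr !(innerC x). Qed.

Lemma innerZr a x y : inner x (a *: y) = a * inner x y.
Proof. by rewrite !innerE -scalemxAr mxE. Qed.

Lemma innerZl a x y : inner (a *: x) y = a * inner x y.
Proof. by rewrite innerC innerZr innerC. Qed.

Lemma innerBr x y z : inner x (y - z) = inner x y - inner x z.
Proof. by rewrite -scaleN1r innerDr innerZr mulN1r. Qed.

Lemma innerBl x y z : inner (y - z) x = inner y x - inner z x.
Proof. by rewrite innerC innerBr !(innerC x). Qed.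

Lemma inner_sumr I (r : seq I) (P : pred I) (F : I -> 'cV[R]_n) x :
  inner x (\sum_(i <- r | P i) F i) = \sum_(i <- r | P i) inner x (F i).
Proof.
by rewrite innerE mulmx_sumr summxE; apply: eq_bigr => i _; rewrite innerE.
Qed.

Lemma inner_ge0 x : 0 <= inner x x.
Proof. by apply: sumr_ge0 => i _; rewrite -expr2 sqr_ge0. Qed.

Lemma enorm_sq x : enorm x ^+ 2 = inner x x.
Proof. by rewrite /enorm sqr_sqrtr// inner_ge0. Qed.

Lemma inner0_eq0 x : inner x x = 0 -> x = 0.
Proof.
move/eqP; rewrite psumr_eq0 => [/allP x0|i _]; last by rewrite -expr2 sqr_ge0.
apply/matrixP => i j; rewrite ord1 mxE; apply/eqP.
by have := x0 i (mem_index_enum _); rewrite mulf_eq0 orbb.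
Qed.

Lemma cauchy_schwarz x y : inner x y ^+ 2 <= inner x x * inner y y.
Proof.
have [y0|y0] := eqVneq (inner y y) 0.
  by rewrite y0 (inner0_eq0 y0) innerE mulmx0 mxE expr0n mulr0.
have y_gt0 : 0 < inner y y by rewrite lt_def y0 inner_ge0.
have := inner_ge0 (inner y y *: x - inner x y *: y).
rewrite !(innerBl, innerBr, innerZl, innerZr) (innerC y x).
set X := inner x x; set Y := inner y y; set p := inner x y => H.
have : 0 <= Y * (X * Y - p ^+ 2) by apply: le_trans H _; lra.
by rewrite pmulr_rge0// subr_ge0.
Qed.

End InnerProduct.

Lemma inner_mulmxr (R : realType) (n k : nat) (A : 'M[R]_(n, k)) x y :
  inner x (A *m y) = inner (A^T *m x) y.
Proof. by rewrite !innerE trmx_mul trmxK mulmxA. Qed.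

(** The Cauchy-Schwarz inequality in dimension m + 1 for the vectors
    (1, U / sqrt h) and (alpha, sqrt h c). *)
Lemma weighted_cauchy_schwarz (R : realType) (m : nat) (h alpha : R)
    (U c : 'cV[R]_m) : 0 < h ->
  (alpha + inner U c) ^+ 2 <=
  (1 + inner U U / h) * (alpha ^+ 2 + h * inner c c).
Proof.
move=> h0; have CS := cauchy_schwarz U c.
have := inner_ge0 ((alpha / h) *: U - c).
rewrite !(innerBl, innerBr, innerZl, innerZr) (innerC c U).
set a := inner U U in CS *; set b := inner c c in CS *.
set p := inner U c in CS * => /(mulr_ge0 (ltW h0)) H0.
have H : 0 <= a / h * alpha ^+ 2 - 2 * alpha * p + h * b.
  apply: le_trans H0 _; rewrite le_eqVlt; apply/orP; left; apply/eqP.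
  by field; rewrite gt_eqF.
have -> : (1 + a / h) * (alpha ^+ 2 + h * b) =
   alpha ^+ 2 + h * b + a / h * alpha ^+ 2 + a * b by field; rewrite gt_eqF.
lra.
Qed.

Section MaxNorm.
Variable R : realType.

Lemma ler_mxnorm (n k : nat) (M : 'M[R]_(n, k)) i j : `|M i j| <= `|M|.
Proof.
rewrite [leRHS]/Num.norm /= mx_normrE.
by rewrite (le_bigmax _ (fun ij : 'I_n * 'I_k => `|M ij.1 ij.2|) (i, j)).
Qed.

Lemma mxnorm_le (n k : nat) (M : 'M[R]_(n, k)) (c : R) : 0 <= c ->
  (forall i j, `|M i j| <= c) -> `|M| <= c.
Proof.
move=> c0 Mc; rewrite [leLHS]/Num.norm /= mx_normrE.
by apply/bigmax_leP; split => // ij _; exact: Mc.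
Qed.

Lemma mxnormM (n k l : nat) (M : 'M[R]_(n, k)) (N : 'M[R]_(k, l)) :
  `|M *m N| <= k%:R * `|M| * `|N|.
Proof.
apply: mxnorm_le => [|i j]; first by rewrite !mulr_ge0.
rewrite mxE; apply: le_trans (ler_norm_sum _ _ _) _.
rewrite -mulrA -[k in k%:R]card_ord -sum1_card natr_sum mulr_suml.
rewrite ler_sum// => a _.
by rewrite mul1r normrM ler_pM ?ler_mxnorm.
Qed.

Lemma mxnorm_tr (n k : nat) (M : 'M[R]_(n, k)) : `|M^T| = `|M|.
Proof.
apply/eqP; rewrite eq_le; apply/andP; split; apply: mxnorm_le => // i j.
  by rewrite mxE ler_mxnorm.
by have := ler_mxnorm M^T j i; rewrite mxE.
Qed.

Lemma inner_le_norm (n : nat) (x y : 'cV[R]_n) :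
  `|inner x y| <= n%:R * `|x| * `|y|.
Proof.
rewrite innerE -(mxnorm_tr x); apply: le_trans (mxnormM _ _).
exact: ler_mxnorm.
Qed.

Lemma sqr_mxnorm_le (n : nat) (x : 'cV[R]_n) : `|x| ^+ 2 <= inner x x.
Proof.
rewrite -(sqr_sqrtr (inner_ge0 x)) ler_pXn2r ?nnegrE ?sqrtr_ge0//.
apply: mxnorm_le => [|i j]; first exact: sqrtr_ge0.
rewrite ord1 -sqrtr_sqr ler_sqrt ?inner_ge0// [leRHS](bigD1 i)//= expr2 lerDl.
by apply: sumr_ge0 => l _; rewrite -expr2 sqr_ge0.
Qed.

End MaxNorm.

(** * Integrals over subintervals *)

Section SegmentIntegral.
Variables (R : realType) (T : R).
Notation mu := (@lebesgue_measure R).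
Implicit Types (f g : R -> R) (s t : R).

Lemma integrable_subsegment f s t : 0 <= s -> t <= T ->
  mu.-integrable `[0, T] (EFin \o f) -> mu.-integrable `[s, t] (EFin \o f).
Proof.
move=> s0 tT; apply: integrableS => // x /=; rewrite !in_itv/= => /andP[sx xt].
by rewrite (le_trans s0)// (le_trans xt).
Qed.

Lemma Rintegral_segmentB f s t : 0 <= s -> s <= t -> t <= T ->
  mu.-integrable `[0, T] (EFin \o f) ->
  \int[mu]_(x in `[0, t]) f x - \int[mu]_(x in `[0, s]) f x =
  \int[mu]_(x in `[s, t]) f x.
Proof.
move=> s0 st tT fi; rewrite Rintegral_itvB ?bnd_simp//; last first.
  exact: integrable_subsegment.
rewrite Rintegral_itv_obnd_cbnd//.
have := integrable_subsegment s0 tT fi.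
by apply: integrableS => //; apply: subset_itvr; rewrite bnd_simp.
Qed.

Lemma Rintegral_segment_cst (a s t : R) : s <= t ->
  \int[mu]_(x in `[s, t]) a = a * (t - s).
Proof.
move=> st; rewrite Rintegral_cst//= lebesgue_measure_itv/= lte_fin.
by move: st; rewrite le_eqVlt => /predU1P[->|->]; rewrite ?ltxx ?subrr.
Qed.

Lemma integrable_segment_cst (a s t : R) :
  mu.-integrable `[s, t] (EFin \o cst a).
Proof.
apply/integrableP; split; first exact/measurable_EFinP.
rewrite /= integral_cst//= lebesgue_measure_itv/=.
by case: ifP => _; rewrite ?mule0// -EFinD -EFinM ltry.
Qed.

Lemma dominated_integrable f g s t : measurable_fun `[s, t] f ->
  mu.-integrable `[s, t] (EFin \o g) ->
  (forall x, s <= x <= t -> `|f x| <= g x) ->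
  mu.-integrable `[s, t] (EFin \o f).
Proof.
move=> mf gi fg; apply: le_integrable gi => //; first exact/measurable_EFinP.
move=> x /=; rewrite in_itv/= => xst; rewrite lee_fin.
exact: le_trans (fg _ xst) (ler_norm _).
Qed.

Lemma le_Rintegral_segment f g s t :
  mu.-integrable `[s, t] (EFin \o f) -> mu.-integrable `[s, t] (EFin \o g) ->
  (forall x, s <= x <= t -> f x <= g x) ->
  \int[mu]_(x in `[s, t]) f x <= \int[mu]_(x in `[s, t]) g x.
Proof.
by move=> fi gi fg; apply: le_Rintegral.
Qed.

Lemma norm_Rintegral_segment f g s t :
  mu.-integrable `[s, t] (EFin \o f) -> mu.-integrable `[s, t] (EFin \o g) ->
  (forall x, s <= x <= t -> `|f x| <= g x) ->
  `|\int[mu]_(x in `[s, t]) f x| <= \int[mu]_(x in `[s, t]) g x.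
Proof.
move=> fi gi fg; apply: le_trans (le_normr_Rintegral _ _) _ => //.
apply: le_Rintegral_segment => //.
exact: integrable_norm.
Qed.

Lemma integrable_EFinZl (s t c : R) f :
  mu.-integrable `[s, t] (EFin \o f) ->
  mu.-integrable `[s, t] (EFin \o (fun x => c * f x)).
Proof.
by move=> fi; refine (@integrableZl _ _ _ mu `[s, t]%classic _ c _ fi).
Qed.

Lemma integrable_EFinD s t f g :
  mu.-integrable `[s, t] (EFin \o f) -> mu.-integrable `[s, t] (EFin \o g) ->
  mu.-integrable `[s, t] (EFin \o (fun x => f x + g x)).
Proof.
by move=> fi gi; refine (@integrableD _ _ _ mu `[s, t]%classic _ _ _ fi gi).
Qed.

Lemma integrable_EFin_sum s t (I : Type) (r : seq I) (F : I -> R -> R) :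
  (forall i, mu.-integrable `[s, t] (EFin \o F i)) ->
  mu.-integrable `[s, t] (EFin \o (fun x => \sum_(i <- r) F i x)).
Proof.
move=> Fi.
have -> : EFin \o (fun x => \sum_(j <- r) F j x) =
   (fun x => \sum_(j <- r) (EFin \o F j) x)%E.
  by apply/funext => x /=; rewrite sumEFin.
exact: integrable_sum.
Qed.

Lemma Rintegral_sum s t (I : Type) (r : seq I) (F : I -> R -> R) :
  (forall i, mu.-integrable `[s, t] (EFin \o F i)) ->
  \int[mu]_(x in `[s, t]) (\sum_(i <- r) F i x) =
  \sum_(i <- r) \int[mu]_(x in `[s, t]) F i x.
Proof.
move=> Fi; elim: r => [|i r IH].
  rewrite big_nil; under eq_Rintegral do rewrite big_nil.
  by rewrite Rintegral_cst// mul0r.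
rewrite big_cons -IH -RintegralD//.
  by apply: eq_Rintegral => x _; rewrite big_cons.
exact: integrable_EFin_sum.
Qed.

(** With c the mean value of f, integrate 2 c f <= f^2 + c^2. *)
Lemma sqr_Rintegral_segment f s t : s < t ->
  mu.-integrable `[s, t] (EFin \o f) ->
  mu.-integrable `[s, t] (EFin \o (fun x => f x ^+ 2)) ->
  (\int[mu]_(x in `[s, t]) f x) ^+ 2 <=
  (t - s) * \int[mu]_(x in `[s, t]) (f x ^+ 2).
Proof.
move=> st fi f2i; set I := \int[mu]_(x in _) f x; set J := \int[mu]_(x in _) _.
have h0 : 0 < t - s by rewrite subr_gt0.
pose c := I / (t - s).
have : 2 * c * I <= J + c ^+ 2 * (t - s).
  rewrite -Rintegral_segment_cst ?(ltW st)// -RintegralD//; last first.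
    exact: integrable_segment_cst.
  rewrite -RintegralZl//. apply: le_Rintegral_segment.
  - exact: integrable_EFinZl.
  - by apply: integrable_EFinD => //; exact: integrable_segment_cst.
  - move=> x _; rewrite -subr_ge0.
    by rewrite (_ : _ - _ = (f x - c) ^+ 2) ?sqr_ge0//; ring.
rewrite -(ler_pM2l h0).
have -> : (t - s) * (2 * c * I) = 2 * I ^+ 2.
  by rewrite /c; field; rewrite gt_eqF.
have -> : (t - s) * (J + c ^+ 2 * (t - s)) = (t - s) * J + I ^+ 2.
  by rewrite /c; field; rewrite gt_eqF.
lra.
Qed.

End SegmentIntegral.

(** * Continuous matrix functions on a segment *)

Section WithinContinuous.
Variables (R : realType) (n k : nat) (a b : R) (f : R -> 'M[R]_(n, k)).

Lemma abs_continuous_within : abs_continuous a b f ->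
  {within `[a, b], continuous f}.
Proof.
move=> fac; apply/subspace_continuousP => x /=.
rewrite in_itv/= => /andP[ax xb].
apply/cvgrPdist_lt => e e0; have [d d0 fd] := fac e e0.
have fd' y z : a <= y -> y <= z -> z <= b -> z - y < d -> `|f z - f y| < e.
  move=> ay yz zb zyd; have := fd 1%N (fun=> y) (fun=> z).
  rewrite !big_ord1; apply => //.
  by move=> i j _ _ _; rewrite !ord1.
rewrite /= near_withinE; near=> y => /=; rewrite in_itv/= => /andP[ay yb].
have xyd : `|x - y| < d by near: y; exact: cvgr_dist_lt.
have [xy|/ltW yx] := leP x y.
  by rewrite distrC fd'// -(ger0_norm (x := y - x)) ?subr_ge0// distrC.
by rewrite fd'// -(ger0_norm (x := x - y)) ?subr_ge0.
Unshelve. all: by end_near. Qed.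

Hypothesis cf : {within `[a, b], continuous f}.

Lemma within_continuous_coord i j :
  {within `[a, b], continuous (fun t => f t i j)}.
Proof.
move=> x; apply: (@continuous_comp (subspace `[a, b]) _ _ f
  (fun M : 'M[R]_(n, k) => M i j)); [exact: cf|exact: coord_continuous].
Qed.

Lemma measurable_coord i j : measurable_fun `[a, b] (fun t => f t i j).
Proof.
apply: subspace_continuous_measurable_fun => //.
exact: within_continuous_coord.
Qed.

Lemma within_continuous_bounded :
  exists2 K : R, 0 <= K & forall t, a <= t <= b -> `|f t| <= K.
Proof.
have /compact_bounded [M [_ fM]] : compact (f @` `[a, b]).
  by apply: continuous_compact => //; exact: segment_compact.
exists (`|M| + 1) => [|t tab]; first by rewrite addr_ge0.
apply: (fM (`|M| + 1)); first by rewrite (le_lt_trans (ler_norm M))// ltrDl.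
by exists t => //=; rewrite in_itv.
Qed.

Lemma integrable_coord i j :
  lebesgue_measure.-integrable `[a, b] (EFin \o (fun t => f t i j)).
Proof.
have [K _ fK] := within_continuous_bounded.
apply: (@dominated_integrable _ _ (cst K)); first exact: measurable_coord.
  exact: integrable_segment_cst.
by move=> t tab; apply: le_trans (ler_mxnorm _ _ _) (fK _ tab).
Qed.

End WithinContinuous.

(** * First-order expansion of the bilinear equation *)

(** The weight 1 + |a_1| + ... + |a_m| dominates the coefficients of
    A0 + a_1 A_1 + ... + a_m A_m. *)
Definition weight (R : realType) (m : nat) (a : 'cV[R]_m) : R :=
  1 + \sum_(l < m) `|a l 0|.

(** A bound for the norm of A0 + a_1 A_1 + ... + a_m A_m relative to the weight
    of a; the factor n accounts for the max-norm of a product of matrices. *)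
Definition gen_bound (R : realType) (n m : nat) (A0 : 'M[R]_n)
    (A : 'I_m -> 'M[R]_n) : R :=
  n%:R * (`|A0| + \sum_(l < m) `|A l|).

Section Bounds.
Variables (R : realType) (n m : nat) (A0 : 'M[R]_n) (A : 'I_m -> 'M[R]_n).

Lemma weight_ge1 (a : 'cV[R]_m) : 1 <= weight a.
Proof. by rewrite lerDl sumr_ge0. Qed.

Lemma weight_le_sqr (a : 'cV[R]_m) : weight a <= weight a ^+ 2.
Proof. by rewrite expr2 ler_peMl// ?(le_trans ler01)// weight_ge1. Qed.

Lemma sqr_weight_le (a : 'cV[R]_m) :
  weight a ^+ 2 <= 2 + 2 * m%:R * inner a a.
Proof.
have := cauchy_schwarz (const_mx 1) (\col_l `|a l 0|).
have -> : inner (const_mx 1) (\col_l `|a l 0|) = \sum_(l < m) `|a l 0|.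
  by apply: eq_bigr => l _; rewrite !mxE mul1r.
have -> : inner (const_mx 1 : 'cV[R]_m) (const_mx 1) = m%:R.
  rewrite /inner -[m in RHS]card_ord -sum1_card natr_sum.
  by apply: eq_bigr => l _; rewrite !mxE mul1r.
have -> : inner (\col_l `|a l 0|) (\col_l `|a l 0|) = inner a a.
  apply: eq_bigr => l _.
  by rewrite !mxE -normrM -expr2 ger0_norm ?sqr_ge0// expr2.
rewrite /weight; set s := \sum_(l < m) _ => H.
have := sqr_ge0 (s - 1); lra.
Qed.

Lemma gen_bound_ge0 : 0 <= gen_bound A0 A.
Proof. by rewrite mulr_ge0// addr_ge0// sumr_ge0. Qed.

Lemma gen_norm_le (a : 'cV[R]_m) (y : 'cV[R]_n) :
  `|A0 *m y + \sum_(l < m) a l 0 *: (A l *m y)| <=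
  gen_bound A0 A * weight a * `|y|.
Proof.
set s := \sum_(l < m) `|A l|.
have s_ge0 : 0 <= s by rewrite sumr_ge0.
have H1 : `|\sum_(l < m) a l 0 *: (A l *m y)| <=
    (\sum_(l < m) `|a l 0|) * (n%:R * s * `|y|).
  apply: le_trans (ler_norm_sum _ _ _) _; rewrite mulr_suml ler_sum// => l _.
  rewrite normrZ ler_wpM2l//; apply: le_trans (mxnormM _ _) _.
  rewrite ler_wpM2r// ler_wpM2l// /s (bigD1 l)//= lerDl.
  by apply: sumr_ge0.
apply: le_trans (ler_normD _ _) _.
apply: le_trans (lerD (mxnormM _ _) H1) _.
rewrite /gen_bound -/s /weight; set b := \sum_(l < m) `|a l 0|.
have b_ge0 : 0 <= b by rewrite sumr_ge0.
have : 0 <= n%:R * (s + `|A0| * b) * `|y|.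
  by rewrite !mulr_ge0// addr_ge0// mulr_ge0.
lra.
Qed.

End Bounds.

Section BilinearStep.
Variables (R : realType) (n m : nat) (T : R).
Variables (A0 : 'M[R]_n) (A : 'I_m -> 'M[R]_n).
Variables (u : R -> 'cV[R]_m) (x0 : 'cV[R]_n) (S : R -> 'cV[R]_n).
Hypothesis uL2 : L2_fun T u.
Hypothesis S_sol : bilinear_solution T A0 A u x0 S.
Notation mu := (@lebesgue_measure R).

Lemma measurable_weight : measurable_fun `[0, T] (fun t => weight (u t)).
Proof.
apply: measurable_funD => //; apply: measurable_sum => l.
by apply: measurableT_comp => //; exact: uL2.1.
Qed.

Lemma integrable_inner_u :
  mu.-integrable `[0, T] (EFin \o (fun t => inner (u t) (u t))).
Proof.
by apply: eq_integrable uL2.2 => // t _ /=; rewrite enorm_sq.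
Qed.

Lemma integrable_sqr_weight :
  mu.-integrable `[0, T] (EFin \o (fun t => weight (u t) ^+ 2)).
Proof.
apply: (@dominated_integrable _ _ (fun t => 2 + 2 * m%:R * inner (u t) (u t))).
- by apply: measurable_funX; exact: measurable_weight.
- apply: integrable_EFinD; first exact: integrable_segment_cst.
  by apply: integrable_EFinZl; exact: integrable_inner_u.
- by move=> t _; rewrite ger0_norm ?sqr_ge0// sqr_weight_le.
Qed.

Lemma integrable_weight :
  mu.-integrable `[0, T] (EFin \o (fun t => weight (u t))).
Proof.
apply: dominated_integrable integrable_sqr_weight _.
  exact: measurable_weight.
move=> t _; rewrite ger0_norm ?weight_le_sqr//.
exact: le_trans (weight_ge1 _).
Qed.

Lemma integrable_control l :
  mu.-integrable `[0, T] (EFin \o (fun t => u t l 0)).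
Proof.
apply: dominated_integrable integrable_weight _; first exact: uL2.1.
move=> t _; rewrite /weight (bigD1 l)//= addrCA lerDl.
by rewrite addr_ge0// sumr_ge0.
Qed.

Lemma integrable_sqr_control l :
  mu.-integrable `[0, T] (EFin \o (fun t => u t l 0 ^+ 2)).
Proof.
apply: dominated_integrable integrable_inner_u _.
  by apply: measurable_funX; exact: uL2.1.
move=> t _; rewrite ger0_norm ?sqr_ge0// /inner (bigD1 l)//= expr2 lerDl.
by rewrite sumr_ge0// => i _; rewrite -expr2 sqr_ge0.
Qed.

Let rhs t := A0 *m S t + \sum_(l < m) u t l 0 *: (A l *m S t).

Lemma S_within : {within `[0, T], continuous S}.
Proof. exact: abs_continuous_within S_sol.1. Qed.

Lemma measurable_mulmx_coord (B : 'M[R]_n) i :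
  measurable_fun `[0, T] (fun t => (B *m S t) i 0).
Proof.
have -> : (fun t => (B *m S t) i 0) = (fun t => \sum_j B i j * S t j 0).
  by apply/funext => t; rewrite mxE.
apply: measurable_sum => j.
by apply: measurable_funM => //; exact: measurable_coord S_within _ _.
Qed.

Lemma integrable_rhs i : mu.-integrable `[0, T] (EFin \o (fun t => rhs t i 0)).
Proof.
have [K K0 SK] := within_continuous_bounded S_within.
apply: (@dominated_integrable _ _
  (fun t => gen_bound A0 A * K * weight (u t))).
- have -> : (fun t => rhs t i 0) = (fun t => (A0 *m S t) i 0 +
      \sum_(l < m) u t l 0 * (A l *m S t) i 0).
    apply/funext => t; rewrite mxE summxE; congr (_ + _).
    by apply: eq_bigr => l _; rewrite mxE.
  apply: measurable_funD; first exact: measurable_mulmx_coord.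
  apply: measurable_sum => l; apply: measurable_funM; first exact: uL2.1.
  exact: measurable_mulmx_coord.
- by apply: integrable_EFinZl; exact: integrable_weight.
- move=> t tT; apply: le_trans (ler_mxnorm _ _ _) _.
  apply: le_trans (gen_norm_le _ _ _ _) _.
  rewrite mulrAC ler_wpM2r ?(le_trans ler01) ?weight_ge1//.
  by rewrite ler_wpM2l ?gen_bound_ge0// SK.
Qed.

Lemma bilinear_increment s t i : 0 <= s -> s <= t -> t <= T ->
  S t i 0 - S s i 0 = \int[mu]_(r in `[s, t]) rhs r i 0.
Proof.
move=> s0 st tT; rewrite -(Rintegral_segmentB s0 st tT (integrable_rhs i)).
rewrite (S_sol.2 t) ?in_itv/= ?tT ?(le_trans s0)//.
rewrite (S_sol.2 s) ?in_itv/= ?s0 ?(le_trans st)//.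
by rewrite !mxE; ring.
Qed.

(** Both the right-hand side of the equation and the variation of S over [s, t]
    are controlled by the weight, so the remainder is quadratic in the integral
    of the weight, hence by Cauchy-Schwarz at most a multiple of t - s times an
    additive function of the interval. *)
Lemma bilinear_expansion : exists2 C : R, 0 <= C & forall s t,
  0 <= s -> s < t -> t <= T ->
  `|S t - (S s + (t - s) *: (A0 *m S s) +
      \sum_(l < m) (\int[mu]_(r in `[s, t]) u r l 0) *: (A l *m S s))| <=
  C * ((t - s) * \int[mu]_(r in `[s, t]) (weight (u r) ^+ 2)).
Proof.
have [K K0 SK] := within_continuous_bounded S_within.
set c := gen_bound A0 A.
have c0 : 0 <= c := gen_bound_ge0 _ _.
exists (c ^+ 2 * K) => [|s t s0 st tT]; first by rewrite mulr_ge0 ?sqr_ge0.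
have wi := integrable_subsegment s0 tT integrable_weight.
have w2i := integrable_subsegment s0 tT integrable_sqr_weight.
have ri i := integrable_subsegment s0 tT (integrable_rhs i).
have ui l := integrable_subsegment s0 tT (integrable_control l).
have w_ge0 r : 0 <= weight (u r) by rewrite (le_trans ler01) ?weight_ge1.
set W := \int[mu]_(r in `[s, t]) weight (u r).
have W0 : 0 <= W by exact: Rintegral_ge0.
have SW r : s <= r <= t -> `|S r - S s| <= c * K * W.
  move=> /andP[sr rt]; have rT := le_trans rt tT.
  apply: mxnorm_le => [|i j]; first exact: mulr_ge0 (mulr_ge0 c0 K0) W0.
  rewrite ord1 !mxE bilinear_increment//.
  apply: (@le_trans _ _ (\int[mu]_(x in `[s, r]) (c * K * weight (u x)))).
    apply: norm_Rintegral_segment => [||x /andP[sx xr]].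
    - exact: integrable_subsegment s0 rT (integrable_rhs i).
    - apply: integrable_EFinZl.
      exact: integrable_subsegment s0 rT integrable_weight.
    - apply: le_trans (ler_mxnorm _ _ _) _.
      apply: le_trans (gen_norm_le _ _ _ _) _.
      rewrite mulrAC ler_wpM2r// ler_wpM2l// SK//.
      by rewrite (le_trans s0)// (le_trans xr).
  rewrite RintegralZl//; last first.
    exact: integrable_subsegment s0 rT integrable_weight.
  rewrite ler_wpM2l//; first exact: mulr_ge0 c0 K0.
  have wi0 := integrable_weight.
  have := Rintegral_segmentB (le_trans s0 sr) rt tT wi0.
  have := Rintegral_segmentB s0 (ltW st) tT wi0; rewrite -/W => <-.
  rewrite -(Rintegral_segmentB s0 sr rT wi0) lerD2r -subr_ge0 => ->.
  exact: Rintegral_ge0.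
apply: mxnorm_le => [|i j].
  apply: mulr_ge0; first by rewrite mulr_ge0// sqr_ge0.
  apply: mulr_ge0; first by rewrite subr_ge0 ltW.
  by apply: Rintegral_ge0 => r _; rewrite sqr_ge0.
rewrite ord1.
pose a0 := (A0 *m S s) i 0; pose a l := (A l *m S s) i 0.
(* The remainder is the integral of the right-hand side with S r - S s in
   place of S r. *)
have -> : (S t - (S s + (t - s) *: (A0 *m S s) +
    \sum_(l < m) (\int[mu]_(r in `[s, t]) u r l 0) *: (A l *m S s))) i 0 =
  \int[mu]_(r in `[s, t]) (rhs r i 0 - (a0 + \sum_(l < m) a l * u r l 0)).
  rewrite RintegralB//; last first.
    apply: integrable_EFinD; first exact: integrable_segment_cst.
    by apply: integrable_EFin_sum => l; exact: integrable_EFinZl.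
  rewrite -bilinear_increment ?(ltW st)// RintegralD//; last 2 first.
    exact: integrable_segment_cst.
    by apply: integrable_EFin_sum => l; exact: integrable_EFinZl.
  rewrite Rintegral_segment_cst ?(ltW st)// Rintegral_sum; last first.
    by move=> l; exact: integrable_EFinZl.
  rewrite 5!mxE -/a0 summxE.
  rewrite [X in S s i 0 + _ + X](eq_bigr
     (fun l => \int[mu]_(r in `[s, t]) (a l * u r l 0))); last first.
    by move=> l _; rewrite mxE RintegralZl// mulrC.
  ring.
apply: (@le_trans _ _
  (\int[mu]_(r in `[s, t]) (c * (c * K * W) * weight (u r)))).
  apply: norm_Rintegral_segment => [||r rst].
  - have : mu.-integrable `[s, t]
        (EFin \o (fun r => a0 + \sum_(l < m) a l * u r l 0)).
      apply: integrable_EFinD; first exact: integrable_segment_cst.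
      by apply: integrable_EFin_sum => l; exact: integrable_EFinZl.
    move=> /(integrable_EFinZl (-1)) /(integrable_EFinD (ri i)).
    by apply: eq_integrable => // x _ /=; rewrite mulN1r.
  - exact: integrable_EFinZl.
  - have -> : rhs r i 0 - (a0 + \sum_(l < m) a l * u r l 0) =
      (A0 *m (S r - S s) + \sum_(l < m) u r l 0 *: (A l *m (S r - S s))) i 0.
      have BB (B : 'M[R]_n) : (B *m (S r - S s)) i 0 =
          (B *m S r) i 0 - (B *m S s) i 0.
        by rewrite mulmxBr; move: (B *m S r) (B *m S s) => X Y; rewrite !mxE.
      rewrite mxE [RHS]mxE BB -/a0 !summxE opprD addrACA; congr (_ + _).
      rewrite -sumrB; apply: eq_bigr => l _.
      by rewrite [in RHS]mxE BB mxE -/(a l); ring.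
    apply: le_trans (ler_mxnorm _ _ _) _.
    apply: le_trans (gen_norm_le _ _ _ _) _.
    rewrite mulrAC ler_wpM2r// ler_wpM2l//; exact: SW.
rewrite RintegralZl// -/W.
have -> : c * (c * K * W) * W = c ^+ 2 * K * W ^+ 2 by ring.
by rewrite ler_wpM2l ?sqr_Rintegral_segment// mulr_ge0// sqr_ge0.
Qed.

End BilinearStep.

(** * One-step inequalities for the quadratic forms *)

Section BilinearQuadraticStep.
Variables (R : realType) (n m : nat) (T : R).
Variables (A0 : 'M[R]_n) (A : 'I_m -> 'M[R]_n).
Variables (u : R -> 'cV[R]_m) (x0 : 'cV[R]_n) (S : R -> 'cV[R]_n).
Hypothesis uL2 : L2_fun T u.
Hypothesis S_sol : bilinear_solution T A0 A u x0 S.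
Notation mu := (@lebesgue_measure R).

Lemma sqr_control_integral_le s t : 0 <= s -> s < t -> t <= T ->
  let U := \col_l \int[mu]_(r in `[s, t]) u r l 0 in
  inner U U <= (t - s) * \int[mu]_(r in `[s, t]) inner (u r) (u r).
Proof.
move=> s0 st tT /=.
have u2i l := integrable_subsegment s0 tT (integrable_sqr_control uL2 l).
have -> : \int[mu]_(r in `[s, t]) inner (u r) (u r) =
    \sum_(l < m) \int[mu]_(r in `[s, t]) (u r l 0 ^+ 2).
  by rewrite -Rintegral_sum.
rewrite mulr_sumr; apply: ler_sum => l _; rewrite mxE -expr2.
apply: sqr_Rintegral_segment => //.
exact: integrable_subsegment s0 tT (integrable_control uL2 l).
Qed.

(** Apply weighted_cauchy_schwarz to the expansion of x . S(t), with U_l the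
    integral of u_l over [s, t], and absorb the factor 1 + |U|^2 / (t - s) into
    the exponential. *)
Lemma bilinear_step : exists2 C : R, 0 <= C & forall s t x,
  0 <= s -> s < t -> t <= T ->
  inner x (S t) ^+ 2 <=
  expR (\int[mu]_(r in `[s, t]) inner (u r) (u r)) *
    (inner (x + (t - s) *: (A0^T *m x)) (S s) ^+ 2 +
     (t - s) * \sum_(l < m) inner ((A l)^T *m x) (S s) ^+ 2) +
  C * ((t - s) * \int[mu]_(r in `[s, t]) (weight (u r) ^+ 2)) * inner x x.
Proof.
have [K K0 SK] := within_continuous_bounded (S_within S_sol).
have [C C0 expC] := bilinear_expansion uL2 S_sol.
exists (2 * n%:R ^+ 2 * K * C) => [|s t x s0 st tT].
  by rewrite !mulr_ge0.
have h0 : 0 < t - s by rewrite subr_gt0.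
have := expC s t s0 st tT.
set Y := S s + _ + _; set h := t - s in h0 *.
set W := h * \int[mu]_(r in _) _ => HY.
have W0 : 0 <= W.
  by apply: mulr_ge0; [exact: ltW|apply: Rintegral_ge0 => r _; rewrite sqr_ge0].
pose U : 'cV[R]_m := \col_l \int[mu]_(r in `[s, t]) u r l 0.
pose c : 'cV[R]_m := \col_l inner ((A l)^T *m x) (S s).
set alpha := inner (x + _) (S s).
have EY : inner x Y = alpha + inner U c.
  rewrite /Y /alpha !innerDr innerDl innerZl innerZr inner_mulmxr.
  congr (_ + _); rewrite inner_sumr; apply: eq_bigr => l _.
  by rewrite innerZr inner_mulmxr !mxE.
have := weighted_cauchy_schwarz alpha U c h0; rewrite -EY.
have -> : inner c c = \sum_(l < m) inner ((A l)^T *m x) (S s) ^+ 2.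
  by apply: eq_bigr => l _; rewrite mxE expr2.
set Q := alpha ^+ 2 + _ => HQ.
have Q0 : 0 <= Q.
  rewrite addr_ge0 ?sqr_ge0// mulr_ge0 ?(ltW h0)//.
  by apply: sumr_ge0 => l _; rewrite sqr_ge0.
have HE : 1 + inner U U / h <=
    expR (\int[mu]_(r in `[s, t]) inner (u r) (u r)).
  apply: le_trans (expR_ge1Dx _); rewrite lerD2l ler_pdivrMr// mulrC.
  exact: sqr_control_integral_le.
have {HQ}HQ := le_trans HQ (ler_wpM2r Q0 HE).
have [x_ge0 St] : 0 <= `|x| /\ `|S t| <= K.
  by split; [|apply: SK; rewrite tT (le_trans s0 (ltW st))].
have H1 : `|inner x (S t)| <= n%:R * `|x| * K.
  apply: le_trans (inner_le_norm _ _) _.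
  by rewrite ler_wpM2l// mulr_ge0.
have H2 : `|inner x (S t - Y)| <= n%:R * `|x| * (C * W).
  apply: le_trans (inner_le_norm _ _) _.
  by rewrite ler_wpM2l// mulr_ge0.
have H3 : inner x (S t) * inner x (S t - Y) <=
    n%:R ^+ 2 * K * C * W * inner x x.
  apply: le_trans (ler_norm _) _; rewrite normrM.
  apply: le_trans (ler_pM _ _ H1 H2) _ => //.
  have -> : n%:R * `|x| * K * (n%:R * `|x| * (C * W)) =
    n%:R ^+ 2 * K * C * W * `|x| ^+ 2 by ring.
  rewrite ler_wpM2l ?sqr_mxnorm_le//.
  by apply: mulr_ge0 W0; rewrite !mulr_ge0.
move: H3; rewrite innerBr => H3.
have := sqr_ge0 (inner x (S t) - inner x Y); lra.
Qed.

End BilinearQuadraticStep.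

(** The right-hand side of the matrix differential equation. *)
Definition lyapunov_op (R : realType) (n m : nat) (A0 : 'M[R]_n)
    (A : 'I_m -> 'M[R]_n) (X : 'M[R]_n) : 'M[R]_n :=
  A0 *m X + X *m A0^T + \sum_(i < m) A i *m X *m (A i)^T.

Section LyapunovStep.
Variables (R : realType) (n m : nat) (T : R).
Variables (A0 : 'M[R]_n) (A : 'I_m -> 'M[R]_n) (M : 'M[R]_n) (Z : R -> 'M[R]_n).
Hypothesis Z_sol : lyapunov_solution T A0 A M Z.
Notation L := (lyapunov_op A0 A).

Lemma lyapunov_opB X Y : L (X - Y) = L X - L Y.
Proof.
rewrite /lyapunov_op mulmxBr mulmxBl.
under eq_bigr do rewrite mulmxBr mulmxBl.
by rewrite sumrB !opprD [RHS]addrACA [X in _ = X + _]addrACA.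
Qed.

Lemma lyapunov_op_bounded :
  exists2 c : R, 0 <= c & forall X, `|L X| <= c * `|X|.
Proof.
exists (n%:R * `|A0| + n%:R * `|A0| +
        \sum_(i < m) n%:R * (n%:R * `|A i|) * `|A i|) => [|X].
  by rewrite !addr_ge0 ?mulr_ge0// sumr_ge0// => i _; rewrite !mulr_ge0.
rewrite !mulrDl; apply: le_trans (ler_normD _ _) _; apply: lerD.
  apply: le_trans (ler_normD _ _) _; apply: lerD; first exact: mxnormM.
  by apply: le_trans (mxnormM _ _) _; rewrite mxnorm_tr mulrAC.
apply: le_trans (ler_norm_sum _ _ _) _; rewrite mulr_suml ler_sum// => i _.
apply: le_trans (mxnormM _ _) _; rewrite mxnorm_tr [leRHS]mulrAC ler_wpM2r//.
by rewrite -mulrA ler_wpM2l// mxnormM.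
Qed.

(** The mean value theorem is applied entrywise, so r depends on i and j. *)
Lemma lyapunov_mvt s t i j : 0 <= s -> s < t -> t <= T ->
  exists2 r, s <= r <= t & Z t i j - Z s i j = L (Z r) i j * (t - s).
Proof.
case: Z_sol => _ cZ dZ s0 st tT.
pose f r := Z r i j; pose df r := L (Z r) i j.
have fdf r : r \in `]s, t[ -> is_derive r 1 f (df r).
  rewrite in_itv/= => /andP[sr rt].
  have rT : r \in `]0, T[.
    by rewrite in_itv/= (le_lt_trans s0 sr) (lt_le_trans rt tT).
  have [Zr Er] := dZ r rT.
  apply: DeriveDef; first by have /derivable_mxP := Zr; exact.
  have := derive_mx Zr => /matrixP/(_ i j); rewrite mxE => <-.
  by rewrite Er.
have cf : {within `[s, t], continuous f}.
  apply: (@continuous_subspaceW _ _ _ `[0, T]); last first.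
    exact: within_continuous_coord cZ i j.
  move=> r /=; rewrite !in_itv/= => /andP[sr rt].
  by rewrite (le_trans s0)// (le_trans rt).
have [r] := MVT st fdf cf.
rewrite in_itv/= => /andP[sr rt] E; exists r => //.
by rewrite (ltW sr) (ltW rt).
Qed.

Lemma lyapunov_expansion : exists2 C : R, 0 <= C & forall s t,
  0 <= s -> s < t -> t <= T ->
  `|Z t - Z s - (t - s) *: L (Z s)| <= C * (t - s) ^+ 2.
Proof.
have [K K0 ZK] : exists2 K : R, 0 <= K & forall t, 0 <= t <= T -> `|Z t| <= K.
  by case: Z_sol => _ cZ _; exact: within_continuous_bounded cZ.
have [c c0 Lc] := lyapunov_op_bounded.
have lip s t : 0 <= s -> s <= t -> t <= T -> `|Z t - Z s| <= c * K * (t - s).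
  move=> s0; rewrite le_eqVlt => /predU1P[->|st] tT.
    by rewrite !subrr normr0 mulr0.
  have h0 : 0 <= t - s by rewrite subr_ge0 ltW.
  apply: mxnorm_le => [|i j]; first by rewrite !mulr_ge0.
  rewrite mxE [in X in _ + X]mxE.
  have [r /andP[sr rt] ->] := lyapunov_mvt i j s0 st tT.
  rewrite normrM (ger0_norm h0) ler_wpM2r//.
  apply: le_trans (ler_mxnorm _ _ _) _; apply: le_trans (Lc _) _.
  by rewrite ler_wpM2l// ZK// (le_trans s0)// (le_trans rt).
exists (c * (c * K)) => [|s t s0 st tT]; first by rewrite !mulr_ge0.
have h0 : 0 <= t - s by rewrite subr_ge0 ltW.
apply: mxnorm_le => [|i j]; first by rewrite !mulr_ge0.
rewrite mxE [X in X + _]mxE [in X in _ + X + _]mxE [in X in _ + X]mxE.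
rewrite [in X in _ - X]mxE.
have [r /andP[sr rt] ->] := lyapunov_mvt i j s0 st tT.
have -> : L (Z r) i j * (t - s) - (t - s) * L (Z s) i j =
    L (Z r - Z s) i j * (t - s).
  by rewrite lyapunov_opB; move: (L _) (L _) => X Y; rewrite !mxE; ring.
rewrite normrM (ger0_norm h0).
have -> : c * (c * K) * (t - s) ^+ 2 = c * (c * K * (t - s)) * (t - s) by ring.
rewrite ler_wpM2r//.
apply: le_trans (ler_mxnorm _ _ _) _; apply: le_trans (Lc _) _.
rewrite ler_wpM2l//; apply: le_trans (lip _ _ s0 sr (le_trans rt tT)) _.
by rewrite ler_wpM2l ?mulr_ge0// lerD2r.
Qed.

Lemma quadratic_form_le (x : 'cV[R]_n) (X : 'M[R]_n) :
  `|inner x (X *m x)| <= n%:R ^+ 2 * `|X| * inner x x.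
Proof.
apply: le_trans (inner_le_norm _ _) _.
apply: le_trans (ler_wpM2l _ (mxnormM _ _)) _; first exact: mulr_ge0.
have -> : n%:R * `|x| * (n%:R * `|X| * `|x|) =
   n%:R ^+ 2 * `|X| * `|x| ^+ 2 by ring.
by rewrite ler_wpM2l ?sqr_mxnorm_le// mulr_ge0.
Qed.

(** Up to O((t - s)^2), the Euler step Z + (t - s) L(Z) is the positivity
    preserving map
    Z |-> (1 + (t - s) A0) Z (1 + (t - s) A0)^T + (t - s) sum_i A_i Z A_i^T. *)
Lemma lyapunov_step : exists2 C : R, 0 <= C & forall s t x,
  0 <= s -> s < t -> t <= T ->
  let y := x + (t - s) *: (A0^T *m x) in
  inner y (Z s *m y) +
    (t - s) * \sum_(l < m) inner ((A l)^T *m x) (Z s *m ((A l)^T *m x)) -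
    C * (t - s) ^+ 2 * inner x x <= inner x (Z t *m x).
Proof.
have [K K0 ZK] : exists2 K : R, 0 <= K & forall t, 0 <= t <= T -> `|Z t| <= K.
  by case: Z_sol => _ cZ _; exact: within_continuous_bounded cZ.
have [C C0 HC] := lyapunov_expansion.
pose a := n%:R * (n%:R * `|A0| * K) * `|A0|.
have a0 : 0 <= a by rewrite !mulr_ge0.
exists (n%:R ^+ 2 * (C + a)) => [|s t x s0 st tT].
  by rewrite mulr_ge0 ?sqr_ge0// addr_ge0.
rewrite /=; set y := x + _.
have := HC s t s0 st tT; set h := t - s in y *.
set E := Z t - Z s - _ => HE.
have Zt : Z t = Z s + h *: L (Z s) + E.
  by rewrite /E -[Z t - _ - _]addrA -opprD [RHS]addrC subrK.
clearbody E.
have Zs : `|Z s| <= K by rewrite ZK// s0 (le_trans (ltW st)).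
have q1 := quadratic_form_le x E.
have q2 := quadratic_form_le x (A0 *m Z s *m A0^T).
have n2 : 0 <= n%:R ^+ 2 :> R by rewrite sqr_ge0.
have {q1}q1 : - inner x (E *m x) <= n%:R ^+ 2 * C * h ^+ 2 * inner x x.
  apply: le_trans (ler_norm _) _; rewrite normrN; apply: le_trans q1 _.
  by rewrite ler_wpM2r ?inner_ge0// -mulrA ler_wpM2l.
have {q2}q2 : inner x (A0 *m Z s *m A0^T *m x) <= n%:R ^+ 2 * a * inner x x.
  apply: le_trans (ler_norm _) _; apply: le_trans q2 _.
  rewrite ler_wpM2r ?inner_ge0// ler_wpM2l//.
  apply: le_trans (mxnormM _ _) _; rewrite mxnorm_tr /a ler_wpM2r// ler_wpM2l//.
  by apply: le_trans (mxnormM _ _) _; rewrite ler_wpM2l// mulr_ge0.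
have Ey : inner y (Z s *m y) = inner x (Z s *m x) +
    h * (inner x (A0 *m Z s *m x) + inner x (Z s *m A0^T *m x)) +
    h ^+ 2 * inner x (A0 *m Z s *m A0^T *m x).
  rewrite /y mulmxDr -scalemxAr !(innerDl, innerDr, innerZl, innerZr).
  rewrite -!(mulmxA A0) !(inner_mulmxr A0) -!mulmxA.
  ring.
have Es : \sum_(l < m) inner ((A l)^T *m x) (Z s *m ((A l)^T *m x)) =
    inner x ((\sum_(l < m) A l *m Z s *m (A l)^T) *m x).
  rewrite mulmx_suml inner_sumr; apply: eq_bigr => l _.
  by rewrite -!mulmxA -inner_mulmxr.
have h2 := sqr_ge0 h.
rewrite Ey Es Zt /lyapunov_op !mulmxDl -!scalemxAl !mulmxDl.
rewrite !(innerDr, innerZr).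
have := ler_wpM2l h2 q2; lra.
Qed.

End LyapunovStep.

(** * Comparison by Euler steps *)

Section EulerComparison.
Variables (R : realType) (n m : nat) (T : R).
Variables (A0 : 'M[R]_n) (A : 'I_m -> 'M[R]_n).

(** Bounds the image of the identity matrix under
    X |-> (1 + h A0) X (1 + h A0)^T + h sum_l A_l X A_l^T. *)
Lemma euler_growth : exists2 B : R, 0 <= B & forall h x, 0 <= h -> h <= T ->
  let y := x + h *: (A0^T *m x) in
  inner y y + h * \sum_(l < m) inner ((A l)^T *m x) ((A l)^T *m x) <=
  (1 + h * B) * inner x x.
Proof.
pose b := \sum_(l < m) n%:R ^+ 2 * `|A l *m (A l)^T|.
pose B := 2 * (n%:R ^+ 2 * `|A0^T|) + `|T| * (n%:R ^+ 2 * `|A0 *m A0^T|) + b.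
have n2 : 0 <= n%:R ^+ 2 :> R by rewrite sqr_ge0.
have b0 : 0 <= b by apply: sumr_ge0 => l _; rewrite mulr_ge0.
exists B => [|h x h0 hT]; first by rewrite !addr_ge0// !mulr_ge0.
rewrite /= !(innerDl, innerDr, innerZl, innerZr).
have xx := inner_ge0 x.
have trE (M : 'M[R]_n) :
    inner (M^T *m x) (M^T *m x) = inner x (M *m M^T *m x).
  by rewrite -mulmxA [RHS]inner_mulmxr.
rewrite (innerC (A0^T *m x) x).
have Hs : \sum_(l < m) inner ((A l)^T *m x) ((A l)^T *m x) <= b * inner x x.
  rewrite mulr_suml ler_sum// => l _; rewrite trE.
  exact: le_trans (ler_norm _) (quadratic_form_le _ _).
have H1 := le_trans (ler_norm _) (quadratic_form_le x A0^T).
have H2 := le_trans (ler_norm _) (quadratic_form_le x (A0 *m A0^T)).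
rewrite -trE in H2.
have H3 : h * inner (A0^T *m x) (A0^T *m x) <=
    `|T| * (n%:R ^+ 2 * `|A0 *m A0^T| * inner x x).
  apply: ler_pM => //; first exact: inner_ge0.
  exact: le_trans hT (ler_norm _).
have := ler_wpM2l h0 Hs; have := ler_wpM2l h0 H1; have := ler_wpM2l h0 H3.
rewrite /B; lra.
Qed.

(** In the application D t is the quadratic form of a matrix, and the last
    hypothesis says that D t is at least the image of D s under a positivity
    preserving map, up to an error C (t - s) (G t - G s) |x|^2. Over N equal steps of
    length t / N these errors sum up, apart from the bounded growth of
    euler_growth, to t / N times the total increment of G. *)
Lemma euler_comparison (C : R) (G : R -> R) (D : R -> 'cV[R]_n -> R) :
  0 <= C ->
  (forall s t, 0 <= s -> s <= t -> t <= T -> G s <= G t) ->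
  (forall x, 0 <= D 0 x) ->
  (forall s t x, 0 <= s -> s < t -> t <= T ->
    D s (x + (t - s) *: (A0^T *m x)) +
    (t - s) * \sum_(l < m) D s ((A l)^T *m x) -
    C * ((t - s) * (G t - G s)) * inner x x <= D t x) ->
  forall t x, 0 <= t -> t <= T -> 0 <= D t x.
Proof.
move=> C0 Gmono D0 Dstep t x; rewrite le_eqVlt => /predU1P[<-//|t0] tT.
have [B B0 growth] := euler_growth.
(* A lower bound for D at the j-th of the N + 1 time steps. *)
have HN N j y : (j <= N.+1)%N -> let h := t / N.+1%:R in
    - (C * (h * (G (j%:R * h) - G 0)) * (1 + h * B) ^+ j) * inner y y <=
    D (j%:R * h) y.
  move=> jN /=; set h := t / _.
  have h0 : 0 < h by rewrite divr_gt0.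
  have Nh : N.+1%:R * h = t by rewrite mulrC divfK// pnatr_eq0.
  have jh (i : nat) : (i <= N.+1)%N -> i%:R * h <= t.
    by move=> iN; rewrite -Nh ler_pM2r// ler_nat.
  have hT : h <= T by apply: le_trans tT; have := jh 1%N isT; rewrite mul1r.
  elim: j jN y => [|j IH] jN y.
    by rewrite mul0r subrr !(mulr0, mul0r) oppr0 mul0r.
  set s := j%:R * h in IH *; set r := j.+1%:R * h.
  have s0 : 0 <= s by rewrite mulr_ge0// ltW.
  have rs : r - s = h by rewrite /r /s -natr1; ring.
  have sr : s < r by rewrite -subr_gt0 rs.
  have rT : r <= T by apply: le_trans tT; exact: jh.
  have := Dstep s r y s0 sr rT; rewrite rs; apply: le_trans.
  have p0 i : 1 <= (1 + h * B) ^+ i.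
    by rewrite exprn_ege1// lerDl; exact: mulr_ge0 (ltW h0) B0.
  set g := C * (h * (G s - G 0)) * (1 + h * B) ^+ j.
  have g0 : 0 <= g.
    apply: mulr_ge0 (le_trans ler01 (p0 j)).
    apply: mulr_ge0 C0 (mulr_ge0 (ltW h0) _); rewrite subr_ge0.
    exact: Gmono (lexx _) s0 (le_trans (ltW sr) rT).
  have D1 := IH (ltnW jN) (y + h *: (A0^T *m y)).
  have D2 : - g * \sum_(l < m) inner ((A l)^T *m y) ((A l)^T *m y) <=
      \sum_(l < m) D s ((A l)^T *m y).
    by rewrite mulr_sumr ler_sum// => l _; exact: (IH (ltnW jN)).
  have {}D2 := ler_wpM2l (ltW h0) D2.
  have D3 := ler_wpM2l g0 (growth h y (ltW h0) hT).
  have D4 : C * (h * (G r - G s)) * inner y y <=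
      C * (h * (G r - G s)) * inner y y * (1 + h * B) ^+ j.+1.
    apply: ler_peMr => //; apply: mulr_ge0 (inner_ge0 _).
    apply: mulr_ge0 C0 (mulr_ge0 (ltW h0) _); rewrite subr_ge0.
    exact: Gmono s0 (ltW sr) rT.
  have -> : C * (h * (G r - G 0)) * (1 + h * B) ^+ j.+1 =
      g * (1 + h * B) + C * (h * (G r - G s)) * (1 + h * B) ^+ j.+1.
    by rewrite /g exprSr; ring.
  rewrite -/g in D1.
  move: D1 D2 D3 D4; rewrite /=; lra.
(* At time t that bound is O(1 / (N + 1)), as (1 + h B)^(N + 1) <= exp(t B). *)
pose a := C * (t * (G t - G 0)) * expR (t * B) * inner x x.
have a0 : 0 <= a.
  have Gt := Gmono 0 t (lexx _) (ltW t0) tT.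
  apply: mulr_ge0 (inner_ge0 _); apply: mulr_ge0 (expR_ge0 _).
  by apply: mulr_ge0 C0 (mulr_ge0 (ltW t0) _); rewrite subr_ge0.
have Da N : - (a / N.+1%:R) <= D t x.
  have := HN N N.+1 x (leqnn _); rewrite /= [N.+1%:R * (t / _)]mulrC.
  rewrite divfK ?pnatr_eq0//.
  apply: le_trans; rewrite mulNr lerN2.
  have -> : a / N.+1%:R =
      C * (t / N.+1%:R * (G t - G 0)) * expR (t * B) * inner x x.
    by rewrite /a; ring.
  have Gt := Gmono 0 t (lexx _) (ltW t0) tT.
  rewrite ler_wpM2r ?inner_ge0// ler_wpM2l//.
    apply: mulr_ge0 C0 (mulr_ge0 _ _); last by rewrite subr_ge0.
    by rewrite divr_ge0// ltW.
  have -> : t * B = N.+1%:R * (t / N.+1%:R * B).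
    by rewrite mulrA [_ * (t / _)]mulrC divfK ?pnatr_eq0.
  rewrite expRM_natl lerXn2r ?nnegrE ?expR_ge0 ?expR_ge1Dx//.
  by rewrite addr_ge0// mulr_ge0// divr_ge0// ltW.
rewrite leNgt; apply/negP => Dneg.
have d0 : 0 < - D t x by rewrite oppr_gt0.
have := archi_boundP (divr_ge0 a0 (ltW d0)).
case: (Num.bound _) => [|N]; first by rewrite ltNge divr_ge0// ltW.
rewrite ltr_pdivrMr// => aN.
by have := Da N; rewrite lerNl ler_pdivlMr// leNgt mulrC aN.
Qed.

End EulerComparison.

(** * Loewner comparison and integration over the time interval *)

Section Gramian.
Variables (R : realType) (n m k : nat) (T : R).
Variables (A0 : 'M[R]_n) (A : 'I_m -> 'M[R]_n) (S0 : 'M[R]_(n, k)).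
Variables (v : 'cV[R]_k) (u : R -> 'cV[R]_m) (S : R -> 'cV[R]_n).
Variable Z : R -> 'M[R]_n.
Hypothesis T0 : 0 < T.
Hypothesis uL2 : L2_fun T u.
Hypothesis S_sol : bilinear_solution T A0 A u (S0 *m v) S.
Hypothesis Z_sol : lyapunov_solution T A0 A (S0 *m S0^T) Z.
Notation mu := (@lebesgue_measure R).

(** The squared L^2 norm of the control on [0, t]. *)
Let energy t := \int[mu]_(r in `[0, t]) inner (u r) (u r).

Lemma energy_mono s t : 0 <= s -> s <= t -> t <= T -> energy s <= energy t.
Proof.
move=> s0 st tT; rewrite -subr_ge0 /energy (@Rintegral_segmentB _ T)//.
  by apply: Rintegral_ge0 => r _; exact: inner_ge0.
exact: integrable_inner_u.
Qed.

Lemma bilinear_initial : S 0 = S0 *m v.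
Proof.
rewrite (S_sol.2 0) ?in_itv/= ?lexx ?ltW//.
rewrite (_ : mx_integral _ _ = 0) ?addr0//.
by apply/matrixP => i j; rewrite !mxE set_itv1 Rintegral_set1.
Qed.

(** S(t) S(t)^T <= exp(int_0^t |u|^2) |v|^2 Z(t) in the Loewner order. *)
Lemma bilinear_le_lyapunov t x : 0 <= t -> t <= T ->
  inner x (S t) ^+ 2 <= expR (energy t) * inner v v * inner x (Z t *m x).
Proof.
have [CS CS0 HS] := bilinear_step uL2 S_sol.
have [CZ CZ0 HZ] := lyapunov_step Z_sol.
pose G t := \int[mu]_(r in `[0, t]) (weight (u r) ^+ 2).
have w2i := integrable_sqr_weight uL2.
pose D t x := inner v v * inner x (Z t *m x) -
              expR (- energy t) * inner x (S t) ^+ 2.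
have vv := inner_ge0 v.
suff D_ge0 : forall t x, 0 <= t -> t <= T -> 0 <= D t x.
  move=> t0 tT; have := D_ge0 t x t0 tT; rewrite /D subr_ge0 expRN.
  by rewrite ler_pdivrMl ?expR_gt0// mulrA.
apply: (@euler_comparison _ _ _ T A0 A (inner v v * CZ + CS) G).
- by rewrite addr_ge0// mulr_ge0.
- move=> s r s0 sr rT; rewrite -subr_ge0 /G (@Rintegral_segmentB _ T)//.
  by apply: Rintegral_ge0 => y _; exact: sqr_ge0.
- move=> y; rewrite /D /energy set_itv1 Rintegral_set1 oppr0 expR0 mul1r.
  rewrite subr_ge0 bilinear_initial inner_mulmxr.
  have [-> _ _] := Z_sol; rewrite -mulmxA inner_mulmxr mulrC.
  exact: cauchy_schwarz.
- move=> s r y s0 sr rT; set h := r - s.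
  have h0 : 0 < h by rewrite subr_gt0.
  have GE : G r - G s = \int[mu]_(q in `[s, r]) (weight (u q) ^+ 2).
    by rewrite /G (@Rintegral_segmentB _ T)// ltW.
  have EE : energy r - energy s = \int[mu]_(q in `[s, r]) inner (u q) (u q).
    rewrite /energy (@Rintegral_segmentB _ T) ?(ltW sr)//.
    exact: integrable_inner_u.
  (* The weight is at least 1, so O(h^2) is absorbed in O(h (G r - G s)). *)
  have hG : h <= G r - G s.
    rewrite GE -[h]mul1r -Rintegral_segment_cst ?(ltW sr)//.
    apply: le_Rintegral_segment; first exact: integrable_segment_cst.
      exact: integrable_subsegment s0 rT w2i.
    by move=> q _; rewrite (le_trans (weight_ge1 _) (weight_le_sqr _)).
  have yy := inner_ge0 y.
  have := HS s r y s0 sr rT; rewrite -EE -GE -/h.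
  have := HZ s r y s0 sr rT; rewrite /= -/h.
  set y' := y + _; rewrite /D.
  rewrite sumrB -!mulr_sumr.
  set qS := inner y' (S s) ^+ 2; set qZ := inner y' (Z s *m y').
  set sS := \sum_(l < m) inner _ (S s) ^+ 2.
  set sZ := \sum_(l < m) inner _ (Z s *m _) => stepZ stepS.
  have e_le1 : expR (- energy r) <= 1.
    rewrite -expR0 ler_expR oppr_le0.
    by apply: Rintegral_ge0 => q _; exact: inner_ge0.
  have e_ge0 := expR_ge0 (- energy r).
  have {}stepS := ler_wpM2l e_ge0 stepS.
  have eE (a b q : R) : expR (- a) * (expR (a - b) * q) = expR (- b) * q.
    by rewrite mulrA -expRD addrA addNr add0r.
  set W := CS * (h * (G r - G s)) * inner y y in stepS.
  have W0 : 0 <= W.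
    by rewrite !mulr_ge0 ?(ltW h0)// (le_trans (ltW h0)).
  have W1 := ler_wpM2r W0 e_le1.
  have {}stepZ := ler_wpM2l vv stepZ.
  have H : inner v v * (CZ * h ^+ 2 * inner y y) <=
      inner v v * (CZ * (h * (G r - G s)) * inner y y).
    by rewrite ler_wpM2l// ler_wpM2r// ler_wpM2l// expr2 ler_wpM2l// ltW.
  rewrite mulrDr eE in stepS.
  have WE : (inner v v * CZ + CS) * (h * (G r - G s)) * inner y y =
    inner v v * (CZ * (h * (G r - G s)) * inner y y) + W by rewrite /W; ring.
  have arith (V qz sz z xz er es qs ss w xs d : R) :
      V * (qz + h * sz - z) <= V * xz ->
      er * xs <= es * (qs + h * ss) + er * w -> er * w <= 1 * w -> V * z <= d ->
      V * qz - es * qs + h * (V * sz - es * ss) - (d + w) <= V * xz - er * xs.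
    by lra.
  by rewrite WE; exact: arith stepZ stepS W1 H.
Qed.

End Gramian.

Section QuadraticFormIntegral.
Variables (R : realType) (n : nat) (T : R) (Z : R -> 'M[R]_n) (x : 'cV[R]_n).
Hypothesis Zi : forall i j,
  lebesgue_measure.-integrable `[0, T] (EFin \o (fun t => Z t i j)).

Let expand : (fun t => inner x (Z t *m x)) =
  (fun t => \sum_(i < n) x i 0 * \sum_(j < n) x j 0 * Z t i j).
Proof.
apply/funext => t; apply: eq_bigr => i _; rewrite mxE; congr (_ * _).
by apply: eq_bigr => j _; rewrite mulrC.
Qed.

Let row_integrable i : lebesgue_measure.-integrable `[0, T]
  (EFin \o (fun t => \sum_(j < n) x j 0 * Z t i j)).
Proof. by apply: integrable_EFin_sum => j; exact: integrable_EFinZl. Qed.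

Lemma integrable_quadratic_form : lebesgue_measure.-integrable `[0, T]
  (EFin \o (fun t => inner x (Z t *m x))).
Proof.
by rewrite expand; apply: integrable_EFin_sum => i; exact: integrable_EFinZl.
Qed.

Lemma Rintegral_quadratic_form :
  \int[lebesgue_measure]_(t in `[0, T]) inner x (Z t *m x) =
  inner x (mx_integral `[0, T] Z *m x).
Proof.
rewrite expand Rintegral_sum => [|i]; last exact: integrable_EFinZl.
apply: eq_bigr => i _; rewrite RintegralZl// mxE; congr (_ * _).
rewrite Rintegral_sum => [|j]; last exact: integrable_EFinZl.
by apply: eq_bigr => j _; rewrite RintegralZl// mxE mulrC.
Qed.

End QuadraticFormIntegral.

Unset Implicit Arguments.

Theorem proposition4p3 (R : realType) (n m k : nat) (T : R)
  (A0 : 'M[R]_n) (A : 'I_m -> 'M[R]_n) (S0 : 'M[R]_(n, k)) (v : 'cV[R]_k)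
  (u : R -> 'cV[R]_m) (S : R -> 'cV[R]_n) (Z : R -> 'M[R]_n) (P : 'M[R]_n)
  (p : 'I_n -> 'cV[R]_n) (lambda : 'I_n -> R) :
  0 < T ->
  L2_fun T u ->
  bilinear_solution T A0 A u (S0 *m v) S ->
  lyapunov_solution T A0 A (S0 *m S0^T) Z ->
  P = mx_integral `[0, T] Z ->
  orthonormal_basis p ->
  (forall i, P *m p i = lambda i *: p i) ->
  forall i : 'I_n,
    (\int[lebesgue_measure]_(t in `[0%R, T]) (`|inner (S t) (p i)| ^+ 2)%:E
     <= (lambda i * expR (L2_sqnorm T u) * enorm v ^+ 2)%:E)%E.
Proof.
move=> T0 uL2 S_sol Z_sol -> p_on Pp i.
have [_ cZ _] := Z_sol.
have Zi := integrable_coord cZ.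
set x := p i.
pose c := expR (L2_sqnorm T u) * inner v v.
have c0 : 0 <= c by rewrite mulr_ge0 ?expR_ge0 ?inner_ge0.
have le_c t : 0 <= t -> t <= T ->
    inner x (S t) ^+ 2 <= c * inner x (Z t *m x).
  move=> t0 tT.
  have H := bilinear_le_lyapunov T0 uL2 S_sol Z_sol x t0 tT.
  have vv := inner_ge0 v.
  have Et := expR_gt0 (\int[lebesgue_measure]_(r in `[0, t]) inner (u r) (u r)).
  (* For v = 0 both sides vanish; otherwise the inequality also shows that the
     quadratic form of Z t is nonnegative. *)
  move: vv; rewrite le_eqVlt => /predU1P[vv|vv].
    by move: H; rewrite /c -vv !(mulr0, mul0r).
  have Zt : 0 <= inner x (Z t *m x).
    by rewrite -(pmulr_rge0 _ (mulr_gt0 Et vv)) (le_trans (sqr_ge0 _) H).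
  apply: le_trans H (ler_wpM2r Zt (ler_wpM2r (ltW vv) _)); rewrite ler_expR.
  apply: le_trans (energy_mono uL2 t0 tT (lexx _)) _.
  rewrite le_eqVlt; apply/orP; left; apply/eqP.
  by apply: eq_Rintegral => r _; rewrite enorm_sq.
have Qi := integrable_quadratic_form x Zi.
have -> : lambda i * expR (L2_sqnorm T u) * enorm v ^+ 2 =
    \int[lebesgue_measure]_(t in `[0, T]) (c * inner x (Z t *m x)).
  rewrite RintegralZl// Rintegral_quadratic_form// Pp innerZr p_on eqxx.
  by rewrite enorm_sq /c mulr1; ring.
have cQi := integrable_EFinZl c Qi.
rewrite fineK; last exact: integrable_fin_num.
apply: ge0_le_integral => //.
- apply/measurable_EFinP; apply: measurable_funX.
  apply: measurableT_comp => //; apply: measurable_sum => j.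
  apply: measurable_funM; last exact: measurable_cst.
  exact: measurable_coord (S_within S_sol) _ _.
- by have /integrableP[] := cQi.
- move=> t /=; rewrite in_itv/= => /andP[t0 tT].
  by rewrite lee_fin real_normK ?num_real// innerC le_c.
Qed.
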